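(* Let $[\mathbb Z^n,\mathcal K]\subseteq[\mathbb R^n,\mathcal K^\star]$, where $\mathcal K^\star$ is the collection of all convex subsets of $\mathbb R^n$ and $\mathcal K=\{C\cap\mathbb Z^n:C\text{ convex}\}$. Let $P'\subseteq\mathbb R^n$ be a polyhedron and let $P=P'\cap\mathbb Z^n$ be the set of integer points in $P'$. Suppose further that $P_I:=\operatorname{conv}(P)$ is a full-dimensional rational polytope. Suppose also that all split disjunctions are allowed as valid disjunctions in the branch-and-cut certificates. Then $$\text{membership complexity of }P\ \le\ \text{facet complexity of }P\ \le\ \text{membership complexity of }P+2.$$
   Context: A relaxation of $K\in\mathcal K$ is a convex set $K'\subseteq\mathbb R^n$ with $K'\cap\mathbb Z^n=K$ (and $K$ is the restriction of $K'$). A halfspace in $[\mathbb R^n,\mathcal K^\star]$ is a convex set $H\subseteq\mathbb R^n$ whose complement is also convex. It is a valid halfspace for $K\in\mathcal K$ if $K\subseteq H\cap\mathbb Z^n$. A valid disjunction is a finite collection of convex sets $D_1,\dots,D_p\subseteq\mathbb R^n$ with $\bigcup_i(D_i\cap\mathbb Z^n)=\mathbb Z^n$. A split disjunction is the valid disjunction $\{x:\langle\alpha,x\rangle\le\beta\}\cup\{x:\langle\alpha,x\rangle\ge\beta+1\}$ for some $\alpha\in\mathbb Z^n\setminus\{0\}$, $\beta\in\mathbb Z$. Here $P$ stands for a system $K_1,\dots,K_t\in\mathcal K$ with $P=K_1\cap\dots\cap K_t$, and $P'$ for a system of relaxations $K'_1,\dots,K'_t$ of these sets with $P'=K'_1\cap\dots\cap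 K'_t$; all complexities are with respect to $K'_1,\dots,K'_t$. A certificate of infeasibility for a system of sets with empty intersection is a binary string that a fixed checking algorithm accepts in time polynomial in the lengths of the system and the string; every infeasible system has one and no feasible system does. Its size is its length. A branch-and-cut tree is a rooted tree in which each node has two labels. The first label is a list $\mathcal L$ of convex sets in $\mathbb R^n$. The second label of an internal node with list $\mathcal L$ is either (a) a valid disjunction $D_1,\dots,D_p$, in which case the node has $p$ children with first labels $\mathcal L\cup\{D_i\}$; or (b) a valid halfspace $G'$ for the intersection of $\mathbb Z^n$ with all sets in $\mathcal L$, in which case the node has two children: the right child has first label $\mathcal L\cup\{G'\}$, and the left child is a leaf, called a cutting plane certifier, whose second label is a certificate of infeasibility (possibly itself a branch-and-cut certificate) for the system consisting of the restrictions of the sets in $\mathcal L$ together with $\mathbb Z^n\setminus G'$. The second label of any other leaf may be empty or hold a certificate of infeasibility. The size of the tree is its total number of nodes plus the sum of the sizes of all infeasibility certificates provided at the nodes with valid halfspaces. One can restrict the families of valid disjunctions and of valid halfspaces that may be used; all complexities are relative to this choice, and a complexity is $+\infty$ if no tree of the required kind exists. Complexities are assumed finite for simplicity (in the infinite case the inequalities are regarded as trivial). For $x\in\mathbb R^n\setminus\operatorname{conv}(P)$, the membership complexity of $x$ is the smallest size of a branch-and-cut tree whose root has first label $\{K'_1,\dots,K'_t\}$ and such that $x\notin\operatorname{conv}(Q)$, where $Q$ is the union, over all leaves, of the intersections of the sets in the first labels of the leaves. The membership complexity of $P$ is the maximum membership complexity over all $x\notin\operatorname{conv}(P)$. For a valid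 halfspace $H'$ for $P$, the validity complexity of $H'$ is the smallest size of a branch-and-cut tree whose root has first label $\{K'_1,\dots,K'_t\}$ and such that for every leaf the intersection of the sets in the first label of the leaf is contained in $H'$. The validity complexity of a facet of $\operatorname{conv}(P)$ is the minimum of the validity complexities of all halfspaces that define that facet. The facet complexity of $P$ (with respect to $P'$) is the maximum validity complexity of all facets of $\operatorname{conv}(P)$.
   Formalization: Two hypotheses are added, without which the bound +2 can fail: the recession cone of P' is rational (true if P' is bounded or rational), and adding sets to a system never lengthens its shortest certificates of infeasibility. *)

(* Defs.v *)
From HB Require Import structures.
From mathcomp Require Import all_boot all_order all_algebra.
From mathcomp Require Import all_classical all_reals all_analysis.
Set Implicit Arguments.
Unset Strict Implicit.
Unset Printing Implicit Defensive.
Import Order.TTheory GRing.Theory Num.Theory.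
Import numFieldNormedType.Exports.
Local Open Scope classical_set_scope.
Local Open Scope ring_scope.

(** * Convex geometry in R^n, points being row vectors *)

Section Geometry.
Variables (R : realType) (n : nat).
Local Notation E := 'rV[R]_n.
Implicit Types (C F H S : set E).

Definition dot (a x : E) : R := (a *m x^T) 0 0.

Definition integer_points : set E :=
  [set map_mx intr z | z in [set: 'rV[int]_n]].

Definition conv_hull S : set E := smallest (@convex_set R E) S.

Definition polyhedron S :=
  exists m (A : 'M[R]_(m, n)) (b : 'cV[R]_m),
    S = [set x | forall i, dot (row i A) x <= b i 0].

Definition rational_polytope S :=
  exists s : seq 'rV[rat]_n, S = conv_hull [set map_mx ratr q | q in [set` s]].

Definition recession_cone S : set E :=
  [set d | forall x t, S x -> 0 <= t -> S (x + t *: d)].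

Definition rational_cone C :=
  exists (m : nat) (g : 'I_m -> 'rV[rat]_n),
    C = [set d | exists c : 'I_m -> R,
           (forall i, 0 <= c i) /\ d = \sum_(i < m) c i *: map_mx ratr (g i)].

(* The affine hull of S has dimension k: the rows of B are a basis of its
   direction space, made of differences of points of S. *)
Definition affine_dim S (k : nat) :=
  exists (x0 : E) (B : 'M[R]_(k, n)),
    [/\ S x0, forall i, S (x0 + row i B), row_free B
      & forall y, S y -> (y - x0 <= B)%MS].

Definition full_dimensional S := affine_dim S n.

Definition is_face C F :=
  exists (a : E) (b : R),
    C `<=` [set x | dot a x <= b] /\ F = C `&` [set x | dot a x = b].

Definition is_facet C F :=
  is_face C F /\ exists k, affine_dim C k.+1 /\ affine_dim F k.

(* Not necessarily closed or open: part of the bounding hyperplane may belong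
   to H; also set0 and setT are halfspaces. *)
Definition halfspace H := convex_set (H : set E) /\ convex_set (~` H : set E).

Definition boundary S : set E := closure S `\` interior S.

Definition defines_facet C F H :=
  [/\ halfspace H, C `<=` H & F = C `&` boundary H].

(** * The convexity space on Z^n, its sets being seen as subsets of R^n *)

Definition lattice_convex S :=
  exists2 C : set E, convex_set C & S = C `&` integer_points.

Definition relaxation (C S : set E) :=
  convex_set C /\ C `&` integer_points = S.

Definition valid_halfspace S H :=
  halfspace H /\ S `<=` H `&` integer_points.

Definition valid_disjunction (Ds : seq (set E)) :=
  (forall D, D \in Ds -> convex_set D) /\
  \big[setU/set0]_(D <- Ds) (D `&` integer_points) = integer_points.

Definition split_disjunction (alpha : 'rV[int]_n) (beta : int) : seq (set E) :=
  [:: [set x | dot (map_mx intr alpha) x <= beta%:~R];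
      [set x | (beta + 1)%:~R <= dot (map_mx intr alpha) x]].

Definition inter (L : seq (set E)) : set E := \big[setI/setT]_(A <- L) A.

Definition restrict (L : seq (set E)) : seq (set E) :=
  [seq A `&` integer_points | A <- L].

End Geometry.

Arguments integer_points {R n}.

(** * Certificates of infeasibility *)

(* [None] is the blank, [Some None] the separator, [Some (Some b)] a bit. *)
Definition symbol : Type := option (option bool).

(* Single-tape Turing machines; the machine halts where [delta] is undefined,
   and moves right when the boolean returned by [delta] is true. *)
Record machine := Machine {
  state : finType;
  start : state;
  accepting : pred state;
  delta : state -> symbol -> option (state * symbol * bool) }.

(* [l] is the tape to the left of the head, nearest cell first; [r] is the
   scanned cell followed by the tape to its right; all other cells are blank. *)
Fixpoint accepts_within (M : machine) (k : nat) (q : state M)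
    (l r : seq symbol) : bool :=
  match delta q (head None r), k with
  | None, _ => accepting q
  | Some _, 0%N => false
  | Some (q', b, true), k'.+1 => accepts_within k' q' (b :: l) (behead r)
  | Some (q', b, false), k'.+1 =>
      accepts_within k' q' (behead l) (head None l :: b :: behead r)
  end.

Definition bits (w : seq bool) : seq symbol := [seq Some (Some b) | b <- w].

(* A binary description of the systems, a machine, and the degree of the
   polynomial that bounds its running time. *)
Record checker (R : realType) (n : nat) := Checker {
  encoding : seq (set 'rV[R]_n) -> seq bool;
  algorithm : machine;
  time_degree : nat }.

Section Certificates.
Variables (R : realType) (n : nat).
Local Notation E := 'rV[R]_n.
Implicit Types (S : seq (set E)).

(* Every polynomial in the total length is dominated by some
   (length + 2) ^ degree. *)
Definition certifies (X : checker R n) S (w : seq bool) : bool :=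
  accepts_within
    ((size (encoding X S) + size w).+2 ^ time_degree X)%N
    (start (algorithm X)) [::]
    (bits (encoding X S) ++ Some None :: bits w).

Definition lattice_system S := forall A, A \in S -> lattice_convex A.

Definition sound_and_complete (X : checker R n) :=
  forall S, lattice_system S ->
    ((exists w, certifies X S w) <-> inter S = set0).

(* Adding sets to a system does not make its infeasibility longer to certify:
   a certificate for a subsystem is good for the whole system. *)
Definition monotone_certificates (X : checker R n) :=
  forall S S' w, lattice_system S -> lattice_system S' ->
    {subset S <= S'} -> certifies X S w ->
    exists2 w', certifies X S' w' & (size w' <= size w)%N.

End Certificates.

(** * Branch-and-cut trees *)

(* Only the second labels are stored: the first labels are determined by that
   of the root.  The left child of a [Cut] node, the cutting plane certifier,
   is represented by its certificate [w]. *)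
Inductive bctree (R : realType) (n : nat) : Type :=
| Leaf (w : option (seq bool))
| Branch (p : nat) (D : p.-tuple (set 'rV[R]_n)) (T : 'I_p -> bctree R n)
| Cut (G : set 'rV[R]_n) (w : seq bool) (T : bctree R n).

(* The checker of certificates, and the families of valid disjunctions and of
   valid halfspaces that may be used. *)
Record bc_setting (R : realType) (n : nat) := BCSetting {
  cert_checker : checker R n;
  disjunctions : set (seq (set 'rV[R]_n));
  halfspaces : set (set 'rV[R]_n) }.

Section Trees.
Variables (R : realType) (n : nat).
Local Notation E := 'rV[R]_n.
Implicit Types (L : seq (set E)) (T : bctree R n) (X : bc_setting R n).

Definition certifier_label (G : set E) L : seq (set E) :=
  integer_points `\` G :: restrict L.

(* [bc_valid X L T]: T is a branch-and-cut tree whose root has first label L. *)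
Fixpoint bc_valid X L T : Prop :=
  match T with
  | Leaf None => True
  | Leaf (Some w) => certifies (cert_checker X) (restrict L) w
  | Branch p D T' =>
      [/\ valid_disjunction D, disjunctions X D
        & forall i, bc_valid X (tnth D i :: L) (T' i)]
  | Cut G w T' =>
      [/\ valid_halfspace (integer_points `&` inter L) G, halfspaces X G,
          certifies (cert_checker X) (certifier_label G L) w
        & bc_valid X (G :: L) T']
  end.

Fixpoint bc_size T : nat :=
  match T with
  | Leaf _ => 1
  | Branch p _ T' => 1 + \sum_(i < p) bc_size (T' i)
  | Cut _ w T' => 2 + size w + bc_size T'
  end%N.

(* The intersections of the first labels of the leaves, including the cutting
   plane certifiers (for which a valid certificate makes it empty). *)
Fixpoint leaf_sets L T : set (set E) :=
  match T with
  | Leaf _ => [set inter L]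
  | Branch p D T' => \bigcup_(i in [set: 'I_p]) leaf_sets (tnth D i :: L) (T' i)
  | Cut G _ T' => inter (certifier_label G L) |` leaf_sets (G :: L) T'
  end.

(** * Complexities, in the extended reals; ereal_inf set0 = +oo *)

Definition min_size (A : set (bctree R n)) : \bar R :=
  ereal_inf [set ((bc_size T)%:R)%:E | T in A].

Definition point_membership_complexity X L (x : E) : \bar R :=
  min_size [set T | bc_valid X L T /\
                    ~ conv_hull (\bigcup_(S in leaf_sets L T) S) x].

Definition membership_complexity X L (P : set E) : \bar R :=
  ereal_sup [set point_membership_complexity X L x | x in ~` conv_hull P].

Definition validity_complexity X L (H : set E) : \bar R :=
  min_size [set T | bc_valid X L T /\ forall S, leaf_sets L T S -> S `<=` H].

Definition facet_validity_complexity X L (P F : set E) : \bar R :=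
  ereal_inf [set validity_complexity X L H | H in defines_facet (conv_hull P) F].

Definition facet_complexity X L (P : set E) : \bar R :=
  ereal_sup [set facet_validity_complexity X L P F
            | F in is_facet (conv_hull P)].

End Trees.

(* Main.v *)
(** Membership versus facet complexity.  A point [x] outside [conv P] violates
    some facet inequality, and every halfspace [H] defining that facet omits [x]:
    otherwise the facet would meet the interior of [conv (P, x)].  Hence a tree
    proving the validity of [H] also separates [x] from the leaves.

    Conversely a facet of the rational polytope [conv P] has an integral
    description [alpha . x <= beta].  Since [P'] is bounded (its recession cone
    is rational and [P] is finite and nonempty), there is a point [x] just above
    the relative interior of the facet lying in [conv (P, y)] for every [y] in
    [P'] with [alpha . y >= beta + 1].  A tree separating [x] thus has no leaf
    point with [alpha . y >= beta + 1]; putting it below the right branch of the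
    split on [(alpha, beta)], whose left branch is a bare leaf, costs two more
    nodes and proves the facet inequality. *)

Require Import Defs.
From mathcomp Require Import all_boot all_order all_algebra.
From mathcomp Require Import all_classical all_reals all_analysis.
From mathcomp Require Import ring lra.
Import Order.TTheory GRing.Theory Num.Theory.
Import numFieldNormedType.Exports.
Local Open Scope classical_set_scope.
Local Open Scope ring_scope.
Set Implicit Arguments.
Unset Strict Implicit.
Unset Printing Implicit Defensive.

(** * The standard inner product and its bound by the sup norm *)

Section Dot.
Variables (R : realType) (n : nat).
Implicit Types (a x y : 'rV[R]_n).

Lemma dotE a x : dot a x = \sum_j a 0 j * x 0 j.
Proof. by rewrite /dot mxE; apply: eq_bigr => j _; rewrite mxE. Qed.

Lemma dotC a x : dot a x = dot x a.
Proof. by rewrite !dotE; apply: eq_bigr => j _; rewrite mulrC. Qed.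

Lemma dotDr a x y : dot a (x + y) = dot a x + dot a y.
Proof. by rewrite /dot linearD mulmxDr mxE. Qed.

Lemma dotZr a k x : dot a (k *: x) = k * dot a x.
Proof. by rewrite /dot linearZ -scalemxAr mxE. Qed.

Lemma dotBr a x y : dot a (x - y) = dot a x - dot a y.
Proof. by rewrite dotDr -scaleN1r dotZr mulN1r. Qed.

Lemma dotDl a x y : dot (x + y) a = dot x a + dot y a.
Proof. by rewrite dotC dotDr !(dotC a). Qed.

Lemma dotZl a k x : dot (k *: x) a = k * dot x a.
Proof. by rewrite dotC dotZr dotC. Qed.

Lemma dot0r a : dot a 0 = 0.
Proof. by rewrite -(scale0r a) dotZr mul0r. Qed.

Lemma dot0l a : dot 0 a = 0.
Proof. by rewrite dotC dot0r. Qed.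

Lemma dotNl a x : dot (- a) x = - dot a x.
Proof. by rewrite -scaleN1r dotZl mulN1r. Qed.

Lemma dot_sumr a m (c : 'I_m -> R) (v : 'I_m -> 'rV[R]_n) :
  dot a (\sum_i c i *: v i) = \sum_i c i * dot a (v i).
Proof.
elim/big_rec2: _ => [|i u y _ <-]; first exact: dot0r.
by rewrite dotDr dotZr.
Qed.

Lemma dot_gt0 a : a != 0 -> 0 < dot a a.
Proof.
move=> a0; have [j aj] : exists j, a 0 j != 0.
  by apply/rV0Pn.
rewrite dotE (bigD1 j)//= ltr_wpDr ?sumr_ge0// => [i _|]; last first.
  by rewrite -expr2 lt_def sqrf_eq0 aj sqr_ge0.
by rewrite -expr2 sqr_ge0.
Qed.

Lemma dot_mulmx a m (c : 'rV[R]_m) (B : 'M[R]_(m, n)) :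
  (forall i, dot a (row i B) = 0) -> dot a (c *m B) = 0.
Proof.
move=> h; rewrite mulmx_sum_row (dot_sumr a (fun i => c 0 i)).
by rewrite big1// => i _; rewrite h mulr0.
Qed.

Lemma dot_submx a m (B : 'M[R]_(m, n)) x :
  (forall i, dot a (row i B) = 0) -> (x <= B)%MS -> dot a x = 0.
Proof. by move=> h /submxP[c ->]; exact: dot_mulmx. Qed.

Lemma dot_rows_eq0 a m (B : 'M[R]_(m, n)) :
  (forall i, dot a (row i B) = 0) <-> a *m B^T = 0.
Proof.
split=> [h|h i].
  apply/rowP => i; rewrite [LHS]mxE [RHS]mxE -[RHS](h i) dotE.
  by apply: eq_bigr => j _; rewrite !mxE.
move: h => /rowP/(_ i); rewrite [LHS]mxE [RHS]mxE => <-; rewrite dotE.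
by apply: eq_bigr => j _; rewrite !mxE.
Qed.

Lemma normrV_le x (e : R) :
  0 <= e -> (`|x| <= e) = [forall j, `|x 0 j| <= e].
Proof.
move=> e0; rewrite [`|x|]mx_normrE; apply/idP/idP.
  move=> /bigmax_leP[_ h]; apply/forallP => j.
  exact: (h (0, j)).
move=> /forallP h; apply/bigmax_leP; split=> // -[i j] _ /=.
by rewrite (ord1 i).
Qed.

Lemma dot_norm_le a x : `|dot a x| <= (\sum_j `|a 0 j|) * `|x|.
Proof.
rewrite dotE mulr_suml (le_trans (ler_norm_sum _ _ _))// ler_sum// => j _.
rewrite normrM ler_wpM2l//.
by move: (lexx `|x|); rewrite {1}normrV_le// => /forallP.
Qed.

End Dot.

(** * Convex sets, convex hulls and Farkas' lemma *)

Section Convex.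
Variables (R : realType) (n : nat).
Local Notation E := 'rV[R]_n.
Implicit Types (A S : set E).

Lemma convex_setP A : convex_set (A : set E) <->
  forall x y (t : R), 0 <= t -> t <= 1 -> A x -> A y ->
    A (t *: x + (1 - t) *: y).
Proof.
split=> h.
  move=> x y t t0 t1 Ax Ay.
  have := h x y (@Itv01 _ t t0 t1); rewrite !inE => /(_ Ax Ay); exact.
move=> x y l; rewrite !inE => Ax Ay; apply: h => //.
Qed.

Lemma convexI A S : convex_set (A : set E) -> convex_set (S : set E) ->
  convex_set (A `&` S : set E).
Proof.
move=> /convex_setP cA /convex_setP cS; apply/convex_setP.
by move=> x y t t0 t1 [Ax Sx] [Ay Sy]; split; [exact: cA|exact: cS].
Qed.

Lemma convex_le (a : E) (b : R) : convex_set ([set x | dot a x <= b] : set E).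
Proof.
apply/convex_setP => x y t t0 t1 /=; rewrite dotDr !dotZr => hx hy.
by nra.
Qed.

Lemma convex_ge (a : E) (b : R) : convex_set ([set x | b <= dot a x] : set E).
Proof.
apply/convex_setP => x y t t0 t1 /=; rewrite dotDr !dotZr => hx hy.
by nra.
Qed.

Lemma convex_lt (a : E) (b : R) : convex_set ([set x | dot a x < b] : set E).
Proof.
apply/convex_setP => x y t t0 t1 /=; rewrite dotDr !dotZr => hx hy.
have [->|tp] := eqVneq t 0; first by lra.
have : 0 < t by rewrite lt_def tp.
by nra.
Qed.

Lemma convex_gt (a : E) (b : R) : convex_set ([set x | b < dot a x] : set E).
Proof.
have -> : [set x | b < dot a x] = [set x | dot (- a) x < - b].
  by apply/seteqP; split=> x /=; rewrite dotNl ltrN2.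
exact: convex_lt.
Qed.

Lemma convex_sum A m (c : 'I_m -> R) (v : 'I_m -> E) :
  convex_set (A : set E) -> (forall i, 0 <= c i) -> (forall i, A (v i)) ->
  \sum_i c i = 1 -> A (\sum_i c i *: v i).
Proof.
move=> /convex_setP cA; elim: m => [|m IH] in c v *.
  by rewrite big_ord0 => _ _ /esym/eqP; rewrite oner_eq0.
move=> c0 Av; rewrite !big_ord_recr /=.
set s := \sum_(i < m) _ => s1.
have s0 : 0 <= s by rewrite sumr_ge0.
have cm : c ord_max = 1 - s by lra.
(* If [s] vanishes, all the weight sits on the last point; otherwise the first weights are
   normalized by [s] and the induction hypothesis applies. *)
have [sz|sN0] := eqVneq s 0.
  rewrite big1 ?add0r; last first.
    by move=> i _; rewrite (psumr_eq0P _ sz)// scale0r.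
  by rewrite cm sz subr0 scale1r.
rewrite cm; have -> : \sum_(i < m) c (widen_ord (leqnSn m) i) *:
    v (widen_ord (leqnSn m) i) =
  s *: \sum_(i < m) (c (widen_ord (leqnSn m) i) / s) *:
    v (widen_ord (leqnSn m) i).
  rewrite scaler_sumr; apply: eq_bigr => i _; rewrite scalerA; congr (_ *: _).
  by field.
apply: cA => //.
- by have := c0 ord_max; rewrite cm subr_ge0.
- apply: IH => //; first by move=> i; rewrite divr_ge0.
  by rewrite -mulr_suml divff.
Qed.

Lemma conv_hull_sub S A : convex_set (A : set E) -> S `<=` A ->
  conv_hull S `<=` A.
Proof. by move=> cA SA; exact: smallest_sub. Qed.

Lemma sub_conv_hull S : S `<=` conv_hull S.
Proof. exact: sub_gen_smallest. Qed.

Lemma convex_conv_hull S : convex_set (conv_hull S : set E).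
Proof.
apply/convex_setP => x y t t0 t1 Sx Sy A [cA SA].
by move/convex_setP : (cA); apply => //; [exact: Sx|exact: Sy].
Qed.

Lemma conv_hull0 : conv_hull (set0 : set E) = set0.
Proof.
apply/seteqP; split=> //; exact: conv_hull_sub.
Qed.

(* The points of [conv_hull S] that lie strictly below the hyperplane or in
   [conv_hull (S `&` H)] form a convex set containing [S]. *)
Lemma conv_hull_face S (a : E) (b : R) : S `<=` [set x | dot a x <= b] ->
  conv_hull S `&` [set x | dot a x = b] `<=`
  conv_hull (S `&` [set x | dot a x = b]).
Proof.
move=> Sab; set U := conv_hull (S `&` _).
have Ua : U `<=` [set x | dot a x = b].
  have -> : [set x | dot a x = b] =
      [set x | dot a x <= b] `&` [set x | b <= dot a x].
    apply/seteqP; split=> x /=; first by move=> ->.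
    by move=> [h1 h2]; apply/eqP; rewrite eq_le h1.
  apply: conv_hull_sub; first by apply: convexI; [exact: convex_le|exact: convex_ge].
  by move=> x [_ /= ->].
suff h : conv_hull S `<=` [set x | dot a x < b] `|` U.
  by move=> x [/h [/=|//] + /= e]; rewrite e ltxx.
apply: conv_hull_sub; last first.
  move=> x Sx; have := Sab _ Sx; rewrite /= le_eqVlt => /orP[/eqP e|]; last by left.
  by right; apply: sub_conv_hull.
apply/convex_setP => x y t t0 t1 hx hy.
have [->|tN0] := eqVneq t 0.
  by rewrite scale0r add0r subr0 scale1r.
have [->|tN1] := eqVneq t 1.
  by rewrite subrr scale0r addr0 scale1r.
have {}t0 : 0 < t by rewrite lt_def tN0.
have {}t1 : t < 1 by rewrite lt_neqAle tN1.
case: (hx) (hy) => [hx'|Ux] [hy'|Uy] /=.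
- by left; rewrite dotDr !dotZr; move: hx' hy' => /=; nra.
- by left; rewrite dotDr !dotZr (Ua _ Uy); move: hx' => /=; nra.
- by left; rewrite dotDr !dotZr (Ua _ Ux); move: hy' => /=; nra.
- right; have /convex_setP := @convex_conv_hull (S `&` [set x | dot a x = b]).
  by apply => //; apply: ltW.
Qed.

End Convex.

(* Bartl's induction: if [a0] separates [w] from all the vectors but the first
   one, project along the first vector onto the kernel of [a0]. *)
Lemma farkas (R : realType) (n m : nat) (v : 'I_m -> 'rV[R]_n) (w : 'rV[R]_n) :
  (forall a, (forall i, dot a (v i) <= 0) -> dot a w <= 0) ->
  exists c : 'I_m -> R, (forall i, 0 <= c i) /\ w = \sum_i c i *: v i.
Proof.
elim: m v w => [|m IH] v w h.
  exists (fun=> 0); split=> //; rewrite big_ord0; apply/eqP.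
  apply: contraT => w0; have := dot_gt0 w0.
  by rewrite ltNge h// => -[].
pose v' i := v (lift ord0 i).
pose cons (e : R) (c : 'I_m -> R) i := oapp c e (unlift ord0 i).
have cons_ge0 e c : 0 <= e -> (forall i, 0 <= c i) -> forall i, 0 <= cons e c i.
  by move=> e0 c0 i; rewrite /cons; case: unliftP => [j _|_] /=.
have sum_cons e c : \sum_i cons e c i *: v i = e *: v ord0 + \sum_i c i *: v' i.
  rewrite big_ord_recl /cons unlift_none /=; congr (_ + _).
  by apply: eq_bigr => i _; rewrite liftK.
have [hm|] := pselect (forall a, (forall i, dot a (v' i) <= 0) -> dot a w <= 0).
  have [c [c0 ->]] := IH v' w hm.
  exists (cons 0 c); split; first exact: cons_ge0.
  by rewrite sum_cons scale0r add0r.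
move=> /existsNP[a0 /not_implyP[a0v /negP]]; rewrite -ltNge => a0w.
have p0 : 0 < dot a0 (v ord0).
  rewrite ltNge; apply/negP => p0; move: a0w; rewrite ltNge => /negP; apply.
  by apply: h => i; case: (unliftP ord0 i) => [j ->|->]; [exact: a0v|].
set p := dot a0 (v ord0) in p0.
pose proj x := x - (dot a0 x / p) *: v ord0.
have [|c [c0 wE]] := IH (proj \o v') (proj w).
  (* The functional fed to [h] is [a] composed with [proj]; it vanishes at [v ord0]. *)
  move=> a hva; have := h (a - (dot a (v ord0) / p) *: a0).
  have adj x : dot (a - (dot a (v ord0) / p) *: a0) x = dot a (proj x).
    by rewrite -scaleNr dotDl dotZl dotBr dotZr; field; rewrite gt_eqF.
  rewrite adj; apply => i; rewrite adj; case: (unliftP ord0 i) => [j ->|->].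
    exact: hva.
  by rewrite dotBr dotZr divff ?gt_eqF// mul1r subrr.
(* Pairing the desired identity with [a0] forces this coefficient of [v ord0]. *)
exists (cons ((dot a0 w - \sum_i c i * dot a0 (v' i)) / p) c); split.
  apply: cons_ge0 => //; rewrite divr_ge0 ?(ltW p0)// subr_ge0.
  by apply: le_trans (ltW a0w); apply: sumr_le0 => i _; rewrite mulr_ge0_le0.
rewrite sum_cons; set s := \sum_i c i * _.
have sumE : \sum_i c i *: (proj \o v') i = \sum_i c i *: v' i - (s / p) *: v ord0.
  rewrite mulr_suml scaler_suml -sumrB; apply: eq_bigr => i _.
  by rewrite /= scalerBr scalerA mulrA.
move: wE; rewrite sumE => /eqP; rewrite subr_eq => /eqP wE; rewrite {1}wE.
by rewrite mulrBl scalerBl addrC addrCA addrC.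
Qed.

(** * Linear independence and affine dimension *)

Lemma row_free_col_mx (F : fieldType) r n (B : 'M[F]_(r, n)) (w : 'rV[F]_n) :
  row_free B -> ~~ (w <= B)%MS -> row_free (col_mx B w).
Proof.
move=> Bf wB; rewrite -row_leq_rank -addsmxE addn1.
have : (B < B + w)%MS by rewrite ltmxE addsmxSl addsmx_sub submx_refl.
by move=> /rank_ltmx; rewrite (eqP Bf).
Qed.

Lemma orthogonal_vector (R : realType) r n (B : 'M[R]_(r, n)) : (r < n)%N ->
  exists2 d : 'rV[R]_n, d != 0 & forall i, dot d (row i B) = 0.
Proof.
move=> rn; have : kermx B^T != 0.
  rewrite -mxrank_eq0 mxrank_ker mxrank_tr -lt0n subn_gt0.
  exact: leq_ltn_trans (rank_leq_row _) rn.
case/rowV0Pn => d /sub_kermxP dB d0; exists d => //.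
exact/dot_rows_eq0.
Qed.

Lemma row_free_orthogonal (R : realType) r n (B : 'M[R]_(r, n)) (a : 'rV[R]_n) :
  row_free B -> a != 0 -> (forall i, dot a (row i B) = 0) -> (r < n)%N.
Proof.
move=> Bf a0 /dot_rows_eq0 aB.
have : (a <= kermx B^T)%MS by apply/sub_kermxP.
move=> /mxrankS; rewrite rank_rV a0 mxrank_ker mxrank_tr (eqP Bf).
by rewrite subn_gt0.
Qed.

Section AffineDim.
Variables (R : realType) (n : nat).
Implicit Types S : set 'rV[R]_n.

(** Directions of [S] are differences of points of [S']. Taking [S = S'] in both orders gives
    uniqueness of the dimension. *)
Lemma affine_dim_le S S' k k' : S `<=` S' ->
  affine_dim S k -> affine_dim S' k' -> (k <= k')%N.
Proof.
move=> SS' [x [B [Sx SB Bf _]]] [x' [B' [_ _ _ hB']]].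
suff /mxrankS : (B <= B')%MS.
  by rewrite (eqP Bf) => /leq_trans; apply; exact: rank_leq_row.
apply/row_subP => i.
have -> : row i B = (x + row i B - x') - (x - x').
  by apply/rowP => j; rewrite !mxE; ring.
by rewrite addmx_sub ?eqmx_opp// hB'//; apply: SS'.
Qed.

(** A largest independent family of differences from a fixed base point spans all the others, since
    any difference outside its span would extend it. *)
Lemma affine_dim_exists S : S !=set0 -> exists k, affine_dim S k.
Proof.
move=> [x Sx].
pose p k := `[< exists B : 'M[R]_(k, n), row_free B /\ forall i, S (x + row i B) >].
have p0 : exists k, p k.
  by exists 0; apply/asboolP; exists 0; rewrite /row_free mxrank0; split=> // -[].
have pn k : p k -> (k <= n)%N.
  by move=> /asboolP[B [/eqP Bf _]]; rewrite -{1}Bf; exact: rank_leq_col.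
case: (ex_maxnP p0 pn) => k /asboolP[B [Bf SB]] maxk.
exists k, x, B; split=> // y Sy; apply: contraT => yB.
suff /maxk : p (k + 1)%N by rewrite addn1 ltnn.
apply/asboolP; exists (col_mx B (y - x)); split; first exact: row_free_col_mx.
move=> i; case: (split_ordP i) => j ->; first by rewrite rowKu.
by rewrite rowKd row_id addrC subrK.
Qed.

End AffineDim.

(** * Homogenization: affine functionals on R^n as linear ones on R^(n+1) *)

Section Homogenization.
Variables (R : realType) (n : nat).
Implicit Types (a x y : 'rV[R]_n) (b : R).

Definition homog y : 'rV[R]_(n + 1) := row_mx y (const_mx 1).

Definition affine_form a b : 'rV[R]_(n + 1) := row_mx a (const_mx b).

Lemma dot_homog a b y : dot (affine_form a b) (homog y) = dot a y + b.
Proof.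
rewrite /dot tr_row_mx mul_row_col mxE; congr (_ + _).
by rewrite mxE big_ord1 !mxE mulr1.
Qed.

Lemma affine_formP (u : 'rV[R]_(n + 1)) : exists a b, u = affine_form a b.
Proof.
exists (lsubmx u), (rsubmx u 0 0); rewrite -[LHS](hsubmxK u); congr row_mx.
by apply/rowP => j; rewrite !mxE (ord1 j).
Qed.

Lemma affine_form_eq0 a b : (affine_form a b == 0) = (a == 0) && (b == 0).
Proof.
rewrite row_mx_eq0; congr (_ && _); apply/eqP/eqP => [/rowP/(_ 0)|->].
  by rewrite !mxE.
by apply/rowP => j; rewrite !mxE.
Qed.

Lemma homogB x y : homog x - homog y = row_mx (x - y) 0.
Proof.
by rewrite opp_row_mx add_row_mx; congr row_mx; apply/rowP => j; rewrite !mxE subrr.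
Qed.

Lemma homog_conv (t : R) x y :
  homog (t *: x + (1 - t) *: y) = t *: homog x + (1 - t) *: homog y.
Proof.
rewrite !scale_row_mx add_row_mx; congr row_mx.
by apply/rowP => j; rewrite !mxE; ring.
Qed.

(** This lets a span condition on homogenized points pass from generators to their convex hull. *)
Lemma convex_homog m (Q : 'M[R]_(m, n + 1)) :
  convex_set ([set y | (homog y <= Q)%MS] : set 'rV[R]_n).
Proof.
apply/convex_setP => x y t _ _ /= hx hy; rewrite homog_conv.
by apply: addmx_sub; exact: scalemx_sub.
Qed.

End Homogenization.

(** * Separating a point from a full-dimensional polytope by a facet *)

Section FacetExistence.
Variables (R : realType) (n m : nat) (v : 'I_m -> 'rV[R]_n).
Let C := conv_hull (range v).

(** If no such [u] exists, Farkas' lemma writes [homog x] as a nonnegative combination of the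
    [homog (v i)], and the last coordinate makes the coefficients sum to 1. *)
Lemma conv_hull_separation x : ~ C x ->
  exists u, (forall i, dot u (homog (v i)) <= 0) /\ 0 < dot u (homog x).
Proof.
move=> Cx; apply: contrapT => /forallNP h; apply: Cx.
have [u hu|c [c0 wE]] := @farkas R _ m (fun i => homog (v i)) (homog x).
  rewrite leNgt; apply/negP => ux; apply: (h u); split=> //.
have xE : x = \sum_i c i *: v i.
  have := congr1 lsubmx wE; rewrite row_mxKl linear_sum => ->.
  by apply: eq_bigr => i _; rewrite linearZ /= row_mxKl.
rewrite xE; apply: convex_sum => //; first exact: convex_conv_hull.
  by move=> i; apply: sub_conv_hull; exists i.
have := congr1 (fun w => rsubmx w 0 0) wE.
rewrite row_mxKr mxE => ->; rewrite linear_sum summxE.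
by apply: eq_bigr => i _; rewrite linearZ /= row_mxKr !mxE mulr1.
Qed.

Hypothesis fullC : full_dimensional C.

(** An affine functional that vanishes at the generators vanishes on [C], so its linear part is
    orthogonal to n independent directions. *)
Lemma full_dim_span u : (forall i, dot u (homog (v i)) = 0) -> u = 0.
Proof.
have [a [b ->]] := affine_formP u => uv.
have Cab : C `<=` [set y | dot a y + b = 0].
  apply: conv_hull_sub; last by move=> _ [i _ <-] /=; rewrite -dot_homog.
  apply/convex_setP => x y t _ _ /= hx hy; rewrite dotDr !dotZr.
  have -> : dot a x = - b by lra.
  by have -> : dot a y = - b; [lra|ring].
have [x0 [B [Cx0 CB Bf _]]] := fullC.
have aB i : dot a (row i B) = 0.
  by have := Cab _ (CB i); have := Cab _ Cx0; rewrite /= dotDr; lra.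
have a0 : a = 0.
  apply/eqP; apply: contraT => a0.
  by have := row_free_orthogonal Bf a0 aB; rewrite ltnn.
apply/eqP; rewrite affine_form_eq0 a0 eqxx /=; apply/eqP.
by have := Cab _ Cx0; rewrite /= a0 dot0l add0r.
Qed.

(* Each step rotates the separating functional about its contact points and
   about [x] until it meets a new point. *)
Lemma separation_rank x r : ~ C x -> (r <= n)%N ->
  exists u, [/\ forall i, dot u (homog (v i)) <= 0, 0 < dot u (homog x)
    & exists B : 'M[R]_(r, n + 1), row_free B /\
      forall j, exists2 i, row j B = homog (v i) & dot u (homog (v i)) = 0].
Proof.
move=> Cx; elim: r => [_|r IH rn].
  have [u [uv ux]] := conv_hull_separation Cx.
  exists u; split=> //; exists 0; rewrite /row_free mxrank0; split=> // -[//].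
have [u [uv ux [B [Bf Bu]]]] := IH (ltnW rn).
(* The contact points and [homog x] are r + 1 < n + 1 vectors, which leaves a direction in which to
   rotate. *)
have [|d d0 dB] := @orthogonal_vector R _ _ (col_mx B (homog x)).
  by rewrite ltn_add2r.
have {}dB' j : dot d (row j B) = 0 by rewrite -(rowKu j B (homog x)).
have dx : dot d (homog x) = 0.
  by have := dB (rshift r 0); rewrite rowKd row_id.
(* By [full_dim_span], [d] is nonzero at some generator; the sign of [d] is free. *)
wlog [i0 di0] : d d0 dB' dx {dB} / exists i, 0 < dot d (homog (v i)).
  move=> W; have [i /eqP di] : exists i, dot d (homog (v i)) <> 0.
    by apply/existsNP => h; move/negP: d0; apply; apply/eqP/full_dim_span.
  have [dp|dn|/eqP] := ltgtP (dot d (homog (v i))) 0; last by rewrite (negPf di).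
    apply: (W (- d)); rewrite ?oppr_eq0//.
    - by move=> j; rewrite dotNl dB' oppr0.
    - by rewrite dotNl dx oppr0.
    - by exists i; rewrite dotNl oppr_gt0.
  by apply: (W d) => //; exists i.
(* [F i] is the step at which [u + t *: d] reaches 0 at [v i]; the least one over the generators
   where [d] is positive keeps all values nonpositive. *)
pose F i := - dot u (homog (v i)) / dot d (homog (v i)).
have [i1 di1 mini1] := @arg_minP _ _ _ i0
  (fun i => 0 < dot d (homog (v i))) F di0.
have t0 : 0 <= F i1 by rewrite divr_ge0 ?(ltW di1)// oppr_ge0.
have uE w : dot (u + F i1 *: d) w = dot u w + F i1 * dot d w.
  by rewrite dotDl dotZl.
exists (u + F i1 *: d); split.
- move=> i; rewrite uE; have [di|di] := ltP 0 (dot d (homog (v i))).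
    by have := mini1 _ di; rewrite [leRHS]/F ler_pdivlMr//; lra.
  by have := uv i; have := mulr_ge0_le0 t0 di; lra.
- by rewrite uE dx mulr0 addr0.
rewrite -addn1; exists (col_mx B (homog (v i1))); split.
  (* The new contact point is independent of the old ones because [d] vanishes on these but not on
     it. *)
  apply: row_free_col_mx => //; apply/negP => /(dot_submx dB') e.
  by rewrite e ltxx in di1.
move=> j; case: (split_ordP j) => k ->.
  rewrite rowKu; have [i e ui] := Bu k; exists i => //.
  by rewrite uE ui -e dB' mulr0 addr0.
rewrite rowKd row_id; exists i1 => //.
by rewrite uE /F mulfVK ?subrr// ?gt_eqF// addrN.
Qed.

(** Once the separating functional has n independent homogenized contact points, its contact set has
    dimension n - 1. *)
Lemma facet_separation x : ~ C x ->
  exists a b, [/\ C `<=` [set y | dot a y <= b],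
    is_facet C (C `&` [set y | dot a y = b]) & b < dot a x].
Proof.
move=> Cx; have [u [uv ux [B [Bf Bu]]]] := separation_rank Cx (leqnn n).
have [a [b' uE]] := affine_formP u; subst u.
pose b := - b'; exists a, b.
have va i : dot a (v i) <= b by have := uv i; rewrite dot_homog /b; lra.
have Ca : C `<=` [set y | dot a y <= b].
  by apply: conv_hull_sub; [exact: convex_le|move=> _ [i _ <-]; exact: va].
have bx : b < dot a x by move: ux; rewrite dot_homog /b; lra.
have a0 : a != 0.
  apply/eqP => a0; have [x0 [_ [Cx0 _ _ _]]] := fullC.
  by have := Ca _ Cx0; move: bx; rewrite /= a0 !dot0l; lra.
(* The rows of [B] are indexed by n, so a contact point, and hence a point of the face, requires n
   to be positive. *)
have n0 : (0 < n)%N.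
  by case/rV0Pn : a0 => -[j jn] _; exact: leq_ltn_trans jn.
set F := _ `&` _.
have Fv i : dot (affine_form a b') (homog (v i)) = 0 -> F (v i).
  move=> e; split; first by apply: sub_conv_hull; exists i.
  by move: e; rewrite dot_homog /b /=; lra.
have F0 : F !=set0.
  by have [i _ ui] := Bu (Ordinal n0); exists (v i); exact: Fv.
have [k Fk] := affine_dim_exists F0.
split=> //; split; first by exists a, b.
(* One bound: [a] is orthogonal to the k directions of the face. The other: the n contact points lie
   in the span of these directions and one homogenized point. *)
exists k; suff -> : k.+1 = n by [].
apply/eqP; rewrite eqn_leq; have [y [D [Fy FD Df hD]]] := Fk.
apply/andP; split.
  apply: (row_free_orthogonal Df a0) => i.
  by have [_ /=] := FD i; rewrite dotDr Fy.2; lra.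
have /mxrankS : (B <= col_mx (row_mx D 0) (homog y))%MS.
  apply/row_subP => j; have [i -> ui] := Bu j.
  rewrite -[homog (v i)](subrK (homog y)) homogB -addsmxE.
  apply: addmx_sub_adds => //; have /submxP[c ->] := hD _ (Fv _ ui).
  by apply/submxP; exists c; rewrite mul_mx_row mulmx0.
rewrite (eqP Bf) => /leq_trans nk; rewrite -[k.+1]addn1; apply: nk.
exact: rank_leq_row.
Qed.

End FacetExistence.

(** * Relative interiors of convex sets and of facets *)

Section RelativeInterior.
Variables (R : realType) (n : nat).
Implicit Types (F C H : set 'rV[R]_n) (a x y d f : 'rV[R]_n).

(** The base point [x] receives the remaining weight. *)
Lemma convex_simplex F m (w : 'I_m -> R) x (v : 'I_m -> 'rV[R]_n) :
  convex_set (F : set 'rV[R]_n) -> F x -> (forall i, F (x + v i)) ->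
  (forall i, 0 <= w i) -> \sum_i w i <= 1 -> F (x + \sum_i w i *: v i).
Proof.
move=> cF Fx Fv w0 w1.
pose c i := oapp w (1 - \sum_i w i) (unlift ord0 i).
pose u i := oapp (fun j => x + v j) x (unlift ord0 i).
have c1 : \sum_i c i = 1.
  rewrite big_ord_recl (eq_bigr w) => [|i _]; last by rewrite /c liftK.
  by rewrite /c unlift_none /= subrK.
have -> : x + \sum_i w i *: v i = \sum_i c i *: u i.
  rewrite [RHS]big_ord_recl [in RHS](eq_bigr (fun i => w i *: x + w i *: v i)) => [|i _].
    rewrite big_split /= -scaler_suml addrA /c /u unlift_none /= -scalerDl.
    by rewrite subrK scale1r.
  by rewrite /c /u liftK /= scalerDr.
apply: convex_sum => // i; rewrite /c /u; case: unliftP => [j _|_] //=.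
by rewrite subr_ge0.
Qed.

(** The witness is the barycenter of [x] and the [x + row i B]; a small displacement along the rows
    of [B] keeps all barycentric coordinates nonnegative. *)
Lemma relative_interior F k x (B : 'M[R]_(k, n)) :
  convex_set (F : set 'rV[R]_n) -> F x -> (forall i, F (x + row i B)) ->
  exists f, F f /\ exists2 e, 0 < e &
    forall d, (d <= B)%MS -> `|d| <= e -> F (f + d).
Proof.
move=> cF Fx FB.
pose N : R := k.+1%:R.
have N0 : 0 < N by rewrite ltr0n.
(* [K * |d|] bounds the sum of the absolute values of the coordinates of [d] along the rows of
   [B]. *)
pose K := \sum_i \sum_j `|(col i (pinvmx B))^T 0 j|.
have K0 : 0 <= K by rewrite sumr_ge0// => i _; exact: sumr_ge0.
pose f := x + \sum_i N^-1 *: row i B.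
(* With this radius the coordinates add up to at most 1/(k+1) in absolute value; adding 1 to [K]
   avoids a division by zero. *)
pose e := N^-1 / (K + 1).
have K1 : 0 < K + 1 by lra.
have e0 : 0 < e by rewrite divr_gt0 ?invr_gt0.
have main d : (d <= B)%MS -> `|d| <= e -> F (f + d).
  move=> dB de; set c := d *m pinvmx B.
  have cE : d = \sum_i c 0 i *: row i B by rewrite -mulmx_sum_row mulmxKpV.
  have cdot i : c 0 i = dot (col i (pinvmx B))^T d.
    by rewrite dotC dotE mxE; apply: eq_bigr => j _; rewrite !mxE.
  have sc : \sum_i `|c 0 i| <= N^-1.
    apply: (@le_trans _ _ (K * `|d|)).
      rewrite mulr_suml ler_sum// => i _; rewrite cdot; exact: dot_norm_le.
    apply: (le_trans (ler_wpM2l K0 de)).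
    rewrite /e mulrCA ler_piMr ?invr_ge0 ?(ltW N0)//.
    by rewrite ler_pdivrMr// mul1r lerDl.
  have -> : f + d = x + \sum_i (N^-1 + c 0 i) *: row i B.
    rewrite {1}cE /f -addrA -big_split /=; congr (_ + _).
    by apply: eq_bigr => i _; rewrite scalerDl.
  apply: convex_simplex => // [i|].
    have ci : `|c 0 i| <= N^-1.
      by apply: le_trans sc; rewrite (bigD1 i)//= lerDl sumr_ge0.
    by rewrite -lerBlDl sub0r; exact: lerNnormlW.
  rewrite big_split /= sumr_const card_ord.
  have h : \sum_i c 0 i <= N^-1.
    by apply: le_trans sc; apply: ler_sum => i _; exact: ler_norm.
  have <- : N^-1 *+ k + N^-1 = 1.
    by rewrite -mulrSr -mulr_natr mulVf// gt_eqF.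
  by rewrite lerD2l.
exists f; split; last by exists e.
by rewrite -[f]addr0; apply: main; rewrite ?sub0mx// normr0 ltW.
Qed.

Variables (C F : set 'rV[R]_n) (a : 'rV[R]_n) (b : R) (k : nat).
Hypotheses (convC : convex_set (C : set 'rV[R]_n)) (fullC : full_dimensional C).
Hypotheses (Cab : C `<=` [set x | dot a x <= b]).
Hypotheses (FE : F = C `&` [set x | dot a x = b]).
Hypotheses (dimC : affine_dim C k.+1) (dimF : affine_dim F k).

Lemma facet_codim : n = k.+1.
Proof.
by apply/eqP; rewrite eqn_leq (affine_dim_le (@subset_refl _ C) fullC dimC)
  (affine_dim_le (@subset_refl _ C) dimC fullC).
Qed.

Lemma facet_below : exists2 c, C c & dot a c < b.
Proof.
apply: contrapT => h.
have CF : C `<=` F.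
  move=> y Cy; rewrite FE; split=> //=; apply/eqP; rewrite eq_le (Cab Cy) /=.
  by rewrite leNgt; apply/negP => yb; apply: h; exists y.
by have := affine_dim_le CF dimC dimF; rewrite ltnn.
Qed.

Lemma facet_normal_neq0 : a != 0.
Proof.
have [c _ +] := facet_below; have [y [_ [+ _ _ _]]] := dimF; rewrite FE => -[_ /= <-].
by apply: contraTneq => ->; rewrite !dot0l ltxx.
Qed.

(** The directions of [F] span a space of dimension k = n - 1 inside the hyperplane orthogonal to
    [a], hence all of it. *)
Lemma facet_interior : exists f, F f /\ exists2 e, 0 < e &
  forall d, dot a d = 0 -> `|d| <= e -> F (f + d).
Proof.
have [x [B [Fx FB Bf hB]]] := dimF.
have Fb y : F y -> dot a y = b by rewrite FE => -[].
have cF : convex_set (F : set 'rV[R]_n).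
  have -> : F = C `&` [set y | b <= dot a y].
    rewrite FE; apply/seteqP; split=> y [Cy /= yb]; split=> //=.
      by rewrite yb.
    by apply/eqP; rewrite eq_le (Cab Cy).
  by apply: convexI => //; exact: convex_ge.
have [f [Ff [e e0 he]]] := relative_interior cF Fx FB.
exists f; split=> //; exists e => // d ad; apply: he.
have aB i : dot a (row i B) = 0.
  by have := Fb _ (FB i); rewrite dotDr (Fb _ Fx); lra.
have BK : (B <= kermx a^T)%MS.
  apply/sub_kermxP; rewrite -[B]trmxK -trmx_mul.
  by have /dot_rows_eq0 -> := aB; rewrite trmx0.
have dK : (d <= kermx a^T)%MS.
  by apply/sub_kermxP/rowP => j; rewrite (ord1 j) [RHS]mxE -[RHS]ad dotC.
apply: (submx_trans dK); rewrite -(geq_leqif (mxrank_leqif_sup BK)).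
by rewrite mxrank_ker mxrank_tr rank_rV facet_normal_neq0 (eqP Bf) facet_codim subn1.
Qed.

End RelativeInterior.

(** * Pyramids over a facet and the halfspaces that define it *)

Section Pyramid.
Variables (R : realType) (n : nat).
Implicit Types (F C H : set 'rV[R]_n) (a x y d f : 'rV[R]_n).

(* Points near the relative interior of [F] lie in the pyramid over [F] with
   apex [y], uniformly as [y] ranges over a bounded set away from the
   hyperplane. *)
Lemma facet_pyramid F a (b : R) f (e M g : R) : dot a f = b -> 0 < e -> 0 < g ->
  (forall d, dot a d = 0 -> `|d| <= e -> F (f + d)) ->
  exists2 r, 0 < r & forall y d, g <= `|dot a y - b| -> `|y - f| <= M ->
    `|d| <= r -> 0 <= dot a d / (dot a y - b) ->
    exists z t, [/\ F z, 0 <= t, t <= 1 & f + d = t *: y + (1 - t) *: z].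
Proof.
move=> afb e0 g0 Ff.
(* The weight [t] of the apex will be at most [s * r]. The constant [D] makes [r * D] bound both [t]
   and the norm of [d - t *: (y - f)]. *)
pose s := \sum_j `|a 0 j| / g.
have s0 : 0 <= s by rewrite sumr_ge0// => i _; rewrite divr_ge0// ltW.
pose D := 1 + s * (1 + `|M|).
have sM : 0 <= s * `|M| by rewrite mulr_ge0.
have D1 : 1 <= D by rewrite /D mulrDr mulr1; lra.
have D0 : 0 < D by lra.
pose m := Num.min 1 e.
have m0 : 0 < m by rewrite lt_min ltr01.
have [m1 me] : m <= 1 /\ m <= e by rewrite !ge_min !lexx orbT.
pose r := m / (2 * D).
have rD : r * D = m / 2 by rewrite /r; field; rewrite gt_eqF.
have r0 : 0 < r by rewrite divr_gt0// mulr_gt0.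
clearbody r; exists r => // y d gy yM dr.
set q := dot a y - b in gy *; set t := _ / q => t0.
have q0 : q != 0 by rewrite -normr_gt0; lra.
have tr : t <= s * r.
  rewrite -(ger0_norm t0) normrM normfV ler_pdivrMr ?normr_gt0//.
  apply: (le_trans (dot_norm_le _ _)).
  rewrite /s -mulr_suml -!mulrA ler_wpM2l ?sumr_ge0//.
  apply: (le_trans dr); rewrite mulrCA ler_pMr//.
  by rewrite mulrC ler_pdivlMr// mul1r.
have t2 : t <= 1 / 2.
  have : s * r <= D * r by rewrite ler_wpM2r ?(ltW r0)// /D mulrDr mulr1; lra.
  by rewrite [D * r]mulrC rD; lra.
have dy : `|d - t *: (y - f)| <= e / 2.
  apply: (le_trans (ler_normB _ _)); rewrite normrZ (ger0_norm t0).
  have h1 : t * `|y - f| <= s * r * `|M|.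
    by apply: ler_pM => //; exact: le_trans yM (ler_norm _).
  have : r + s * r * `|M| <= r * D by rewrite /D !mulrDr mulr1; nra.
  by rewrite rD; lra.
have t1 : 0 < 1 - t by lra.
(* This is the solution [z] of [f + d = t *: y + (1 - t) *: z]. The choice of [t] puts it on the
   hyperplane, and t <= 1/2 keeps it within distance [e] of [f]. *)
exists (f + (1 - t)^-1 *: (d - t *: (y - f))), t; split=> //; last 2 first.
- by lra.
- rewrite scalerDr scalerA divff ?gt_eqF// scale1r.
  by apply/rowP => j; rewrite !mxE; ring.
apply: Ff.
  by rewrite dotZr !(dotBr, dotZr) afb -/q divfK// subrr mulr0.
rewrite normrZ normfV (gtr0_norm t1) mulrC ler_pdivrMr//.
by apply: (le_trans dy); rewrite ler_pM2l//; lra.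
Qed.

Lemma nbhs_dot_gt a x (b : R) : b < dot a x -> nbhs x [set y | b < dot a y].
Proof.
move=> bx; pose s := \sum_j `|a 0 j|.
have s0 : 0 <= s by exact: sumr_ge0.
apply/nbhs_ballP; exists ((dot a x - b) / (s + 1)) => /=.
  by rewrite divr_gt0 ?subr_gt0//; lra.
move=> y; rewrite -ball_normE /= ltr_pdivlMr; last by lra.
move=> h; have := dot_norm_le a (x - y); rewrite dotBr -/s.
have := ler_norm (dot a x - dot a y); have := normr_ge0 (x - y).
by rewrite mulrDr mulr1 mulrC in h; lra.
Qed.

Lemma nbhs_dot_lt a x (b : R) : dot a x < b -> nbhs x [set y | dot a y < b].
Proof.
move=> xb; have := @nbhs_dot_gt (- a) x (- b).
by rewrite dotNl ltrN2 => /(_ xb); apply: filterS => y /=; rewrite dotNl ltrN2.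
Qed.

Lemma boundary_le a (b : R) : a != 0 ->
  boundary [set x | dot a x <= b] = [set x | dot a x = b].
Proof.
move=> a0; apply/seteqP; split=> [x [xcl xint]|x /= xb].
  apply/eqP; rewrite eq_le; apply/andP; split.
    rewrite leNgt; apply/negP => /nbhs_dot_gt/xcl[y /= [h1 h2]].
    by move: h2; rewrite ltNge h1.
  rewrite leNgt; apply/negP => /nbhs_dot_lt xn; apply: xint.
  by move: xn; apply: filterS => y /= /ltW.
split; first by apply: subset_closure => /=; rewrite xb.
move=> /nbhs_ballP[r /= r0 xr].
have aa := dot_gt0 a0; have an : 0 < `|a| by rewrite normr_gt0.
(* The displacement [t *: a] has norm r/2, so it stays in the ball but leaves the halfspace. *)
pose t := r / 2 / `|a|.
have t0 : 0 < t by rewrite !divr_gt0.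
have := xr (x + t *: a); rewrite -ball_normE /= opprD addrA subrr add0r normrN.
rewrite normrZ (gtr0_norm t0) /t divfK ?gt_eqF//.
have r2 : r / 2 < r by lra.
move=> /(_ r2); rewrite dotDr dotZr xb -/t.
by have := mulr_gt0 t0 aa; lra.
Qed.

Lemma halfspace_le a (b : R) : halfspace [set x | dot a x <= b].
Proof.
split; first exact: convex_le.
have -> : ~` [set x | dot a x <= b] = [set x | b < dot a x].
  by apply/seteqP; split=> x /=; rewrite ltNge => /negP.
exact: convex_gt.
Qed.

(* A point of [H] beyond the facet would put the facet in the interior of [H]. *)
Lemma defines_facet_sub C a (b : R) k H :
  convex_set (C : set 'rV[R]_n) -> full_dimensional C ->
  C `<=` [set x | dot a x <= b] -> affine_dim C k.+1 ->
  affine_dim (C `&` [set x | dot a x = b]) k ->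
  defines_facet C (C `&` [set x | dot a x = b]) H ->
  H `<=` [set x | dot a x <= b].
Proof.
move=> cC fC Cab dC dF [[cH _] CH FH] x Hx /=; rewrite leNgt; apply/negP => bx.
have [c Cc cb] := facet_below Cab erefl dC dF.
have [f [Ff [e e0 he]]] := facet_interior cC fC Cab erefl dC dF.
have afb : dot a f = b by case: Ff.
move: (Ff); rewrite FH => -[_ [_ fH]]; apply: fH.
(* These bounds serve two apexes at once: [x] above the hyperplane and [c] below it. *)
pose g := Num.min (dot a x - b) (b - dot a c).
pose M := Num.max `|x - f| `|c - f|.
have g0 : 0 < g by rewrite lt_min !subr_gt0 bx.
have [r r0 hr] := facet_pyramid M afb e0 g0 he.
have Hpyr y d : H y -> g <= `|dot a y - b| -> `|y - f| <= M ->
    `|d| <= r -> 0 <= dot a d / (dot a y - b) -> H (f + d).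
  move=> Hy h1 h2 h3 h4; have [z [t [[Cz _] t0 t1 ->]]] := hr _ _ h1 h2 h3 h4.
  by move/convex_setP : cH; apply => //; exact: CH.
apply/nbhs_ballP; exists r => //= y; rewrite -ball_normE /= distrC => /ltW yr.
rewrite -(subrK f y) addrC.
(* Points on the upper side of the hyperplane lie in the pyramid with apex [x], the others in the
   one with apex [c]. *)
have [ad|ad] := leP 0 (dot a (y - f)).
  apply: (Hpyr x) => //; last by rewrite divr_ge0// subr_ge0 ltW.
    by rewrite ger0_norm ?subr_ge0 ?(ltW bx)// ge_min lexx.
  by rewrite le_max lexx.
apply: (Hpyr c) => //; last by rewrite nmulr_rge0// invr_le0 subr_le0 ltW.
- exact: CH.
- by rewrite distrC ger0_norm ?subr_ge0 ?(ltW cb)// ge_min lexx orbT.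
- by rewrite le_max lexx orbT.
Qed.

End Pyramid.

(** * Integral descriptions of the facets of a rational polytope *)

Section Rationality.
Variable R : realType.

Lemma clear_denominators n (r : 'rV[rat]_n) :
  exists (N : nat) (z : 'rV[int]_n), (0 < N)%N /\ N%:R *: r = map_mx intr z.
Proof.
pose P (A : pred 'I_n) : int := \prod_(i | A i) denq (r 0 i).
have P0 A : 0 < P A by apply: prodr_gt0 => i _; exact: denq_gt0.
exists `|P predT|%N, (\row_j (numq (r 0 j) * P (predC1 j))).
split; first by rewrite absz_gt0 gt_eqF.
apply/rowP => j; rewrite !mxE natr_absz (gtr0_norm (P0 _)).
rewrite /P (bigD1 j)//= -/(P (predC1 j)) !rmorphM /=.
rewrite -{2}[r 0 j]divq_num_den.
have : (denq (r 0 j))%:~R != 0 :> rat by rewrite intr_eq0 denq_neq0.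
by move=> d0; field.
Qed.

Lemma map_ratr_clear n (r : 'rV[rat]_n) (N : nat) (z : 'rV[int]_n) :
  N%:R *: r = map_mx intr z -> N%:R *: map_mx ratr r = map_mx intr z :> 'rV[R]_n.
Proof.
move=> /rowP e; apply/rowP => j; have := congr1 (@ratr R) (e j).
by rewrite !mxE rmorphM /= ratr_nat ratr_int.
Qed.

(** The rank condition makes the rational kernel at most a line, and extending scalars to the reals
    does not enlarge it. So [u] is a multiple of a rational vector, whose denominators and sign can
    be adjusted. *)
Lemma rational_kernel m n (Q : 'M[rat]_(m, n)) (u : 'rV[R]_n) :
  u != 0 -> (n <= (\rank Q).+1)%N -> (forall i, dot u (row i (map_mx ratr Q)) = 0) ->
  exists (c : R) (z : 'rV[int]_n), 0 < c /\ u = c *: map_mx intr z.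
Proof.
move=> u0 rQ /dot_rows_eq0 uQ; pose K := kermx Q^T.
have uK : (u <= map_mx ratr K)%MS by rewrite map_kermx -matrix.map_trmx; apply/sub_kermxP.
have : K != 0.
  by apply: contraNneq u0 => K0; move: uK; rewrite K0 map_mx0 submx0.
case/rowV0Pn => r rK r0.
have Kr : (K <= r)%MS.
  rewrite -(geq_leqif (mxrank_leqif_sup rK)) rank_rV r0 mxrank_ker mxrank_tr.
  by rewrite leq_subLR addn1.
have /sub_rVP[c uE] : (u <= map_mx ratr r)%MS.
  by apply: (submx_trans uK); rewrite map_submx.
have [N [z [N0 /map_ratr_clear zE]]] := clear_denominators r.
have {}uE : u = (c / N%:R) *: map_mx intr z.
  by rewrite -zE scalerA divfK ?pnatr_eq0 -?lt0n.
have [cp|cn|c0] := ltgtP 0 (c / N%:R).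
- by exists (c / N%:R), z.
- exists (- (c / N%:R)), (- z); rewrite oppr_gt0; split=> //.
  by rewrite map_mxN scaleNr scalerN opprK.
- by move: u0; rewrite uE -c0 scale0r eqxx.
Qed.

(** The form [(a, -b)] is orthogonal to the homogenized generators on the facet, which are rational
    and span a space of dimension n. *)
Lemma facet_integral n m (q : 'I_m -> 'rV[rat]_n) (C : set 'rV[R]_n) a b k :
  C = conv_hull (range (fun i => map_mx ratr (q i))) ->
  full_dimensional C -> C `<=` [set x | dot a x <= b] ->
  affine_dim C k.+1 -> affine_dim (C `&` [set x | dot a x = b]) k ->
  exists (c : R) (alpha : 'rV[int]_n) (beta : int),
    [/\ 0 < c, a = c *: map_mx intr alpha & b = c * beta%:~R].
Proof.
set v := fun i => _; move=> CE fullC Cab dC dF.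
have a0 := facet_normal_neq0 Cab erefl dC dF.
have nE := facet_codim fullC dC.
(* Generators off the facet contribute zero rows, which affect neither the span nor
   orthogonality. *)
pose Q : 'M[rat]_(m, n + 1) :=
  \matrix_i (if dot a (v i) == b then row_mx (q i) (const_mx 1) else 0).
have rowQ i : row i (map_mx ratr Q) = if dot a (v i) == b then homog (v i) else 0.
  rewrite -map_row rowK; case: ifP => _; last by rewrite map_mx0.
  by rewrite map_row_mx map_const_mx rmorph1.
(* By [conv_hull_face], the facet is generated by the generators lying on it. *)
have FQ y : C y -> dot a y = b -> (homog y <= map_mx ratr Q)%MS.
  move=> Cy yb; have vC : range v `<=` [set x | dot a x <= b].
    by move=> x vx; apply: Cab; rewrite CE; exact: sub_conv_hull.
  have : (C `&` [set x | dot a x = b]) y by [].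
  rewrite CE => /(conv_hull_face vC).
  apply: (@conv_hull_sub _ _ _ [set x | (homog x <= map_mx ratr Q)%MS]).
    exact: convex_homog.
  move=> _ [[i _ <-] /= /eqP vb]; have := row_sub i (map_mx ratr Q : 'M[R]_(m, n + 1)).
  by rewrite rowQ vb.
have u0 : affine_form a (- b) != 0 by rewrite affine_form_eq0 negb_and a0.
have [|i|c [z [c0 uE]]] := @rational_kernel _ _ Q _ u0.
- have [x0 [B [[Cx0 x0b] FB Bf _]]] := dF.
  apply: (@leq_trans n.+1); first by rewrite addn1.
  rewrite ltnS -(mxrank_map (@ratr R)).
  apply: (@leq_trans (k + 1)); first by rewrite {1}nE addn1.
  suff /mxrankS : (col_mx (row_mx B 0) (homog x0) <= map_mx ratr Q)%MS.
    have /eqP -> : row_free (col_mx (row_mx B 0) (homog x0)).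
      apply: row_free_col_mx; first by rewrite /row_free rank_row_mx0.
      apply/submxP => -[d]; rewrite mul_mx_row mulmx0 => /eq_row_mx[_ /rowP/(_ 0)].
      by rewrite !mxE => /eqP; rewrite oner_eq0.
    by [].
  rewrite -addsmxE addsmx_sub FQ// andbT; apply/row_subP => i.
  have -> : row i (row_mx B 0) = homog (x0 + row i B) - homog x0.
    by rewrite row_row_mx homogB addrAC subrr add0r row0.
  by have [? ?] := FB i; rewrite addmx_sub ?eqmx_opp ?FQ.
- rewrite rowQ; case: eqP => [vb|_]; last exact: dot0r.
  by rewrite dot_homog vb subrr.
exists c, (lsubmx z), (- rsubmx z 0 0); split=> //.
  by have := congr1 lsubmx uE; rewrite row_mxKl linearZ /= map_lsubmx.
have := congr1 (fun w => rsubmx w 0 0) uE.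
rewrite row_mxKr !mxE rmorphN mulrN => <-.
by rewrite opprK.
Qed.

End Rationality.

(** * Boundedness of the polyhedron [P'] *)

Section Boundedness.
Variables (R : realType) (n : nat).
Implicit Types (C S : set 'rV[R]_n).

Lemma conv_hull_range_bounded m (v : 'I_m -> 'rV[R]_n) (a : 'rV[R]_n) :
  exists M, conv_hull (range v) `<=` [set x | dot a x <= M].
Proof.
exists (\sum_i `|dot a (v i)|); apply: conv_hull_sub; first exact: convex_le.
move=> _ [i _ <-] /=; rewrite (bigD1 i)//= (le_trans (ler_norm _))//.
by rewrite lerDl sumr_ge0.
Qed.

(** A direction with nonpositive product with every row of [A] is a recession direction, hence zero.
    By Farkas' lemma every functional is then a nonnegative combination of the rows, so it is
    bounded above on [S]. *)
Lemma polyhedron_bounded S : polyhedron S -> recession_cone S `<=` [set 0] ->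
  exists M, forall y, S y -> `|y| <= M.
Proof.
move=> [m [A [b SE]]] rec0.
have bound w : exists M, forall y, S y -> dot w y <= M.
  have [|c [c0 ->]] := @farkas R n m (fun i => row i A) w.
    move=> d Ad; have -> : d = 0; last by rewrite dot0l.
    apply: rec0 => x t; rewrite SE /= => Sx t0 i.
    rewrite dotDr dotZr (dotC _ d); have := mulr_ge0_le0 t0 (Ad i).
    by have := Sx i; lra.
  exists (\sum_i c i * b i 0) => y; rewrite SE /= => Sy.
  rewrite dotC dot_sumr; apply: ler_sum => i _; rewrite dotC.
  by rewrite ler_wpM2l.
have dotd y j : dot (delta_mx 0 j) y = y 0 j :> R.
  rewrite dotE (bigD1 j)//= big1 ?addr0 ?mxE ?eqxx ?mul1r// => i ij.
  by rewrite mxE (negPf ij) mul0r.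
have /choice[M hM] : forall j, exists M, forall y, S y -> `|y 0 j| <= M.
  move=> j; have [M1 h1] := bound (delta_mx 0 j).
  have [M2 h2] := bound (- delta_mx 0 j).
  exists (Num.max M1 M2) => y Sy; have := h1 y Sy; have := h2 y Sy.
  by rewrite dotNl dotd => Mx xM; rewrite ler_norml lerNl !le_max Mx xM orbT.
exists (\sum_j `|M j|) => y Sy; rewrite normrV_le ?sumr_ge0//.
apply/forallP => j; apply: (le_trans (hM j y Sy)).
by rewrite (bigD1 j)//= (le_trans (ler_norm _))// lerDl sumr_ge0.
Qed.

(** A nonzero rational generator has a positive integral multiple, and adding it repeatedly to an
    integer point gives unboundedly many integer points of [S]. Rationality matters: a line of
    irrational slope can contain a single integer point. *)
Lemma recession_cone_trivial S C : rational_cone (recession_cone S) ->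
  S `&` integer_points !=set0 -> S `&` integer_points `<=` C ->
  (forall a, exists M, C `<=` [set x | dot a x <= M]) ->
  recession_cone S `<=` [set 0].
Proof.
move=> [m [g recE]] [p [Sp [zp _ pE]]] SC Cb.
suff g0 i : map_mx ratr (g i) = 0 :> 'rV[R]_n.
  by rewrite recE => _ [c [_ ->]] /=; rewrite big1// => i _; rewrite g0 scaler0.
set d := map_mx _ _; apply/eqP; apply: contraT => d0.
have recd : recession_cone S d.
  rewrite recE; exists (fun j => (j == i)%:R); split=> //.
  rewrite (bigD1 i)//= eqxx scale1r big1 ?addr0// => j /negPf ->.
  by rewrite scale0r.
have [N [z [N0 /(@map_ratr_clear R) zE]]] := clear_denominators (g i).
have [M hM] := Cb d.
have dd := dot_gt0 d0.
have M' k : dot d p + (k * N)%:R * dot d d <= M.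
  rewrite -dotZr -dotDr; apply: hM; apply: SC; split; first exact: recd.
  exists (zp + z *+ k) => //; rewrite raddfD raddfMn /= pE -zE.
  by rewrite -scaler_nat scalerA -natrM.
pose k := Num.truncn ((M - dot d p) / dot d d).
have : (M - dot d p) / dot d d < k.+1%:R by exact: truncnS_gt.
rewrite ltr_pdivrMr//; have := M' k.+1.
have : k.+1%:R * dot d d <= (k.+1 * N)%:R * dot d d.
  by rewrite ler_pM2r// ler_nat leq_pmulr.
by lra.
Qed.

End Boundedness.

(** * Operations on branch-and-cut trees *)

Section Trees.
Variables (R : realType) (n : nat).
Local Notation E := 'rV[R]_n.
Implicit Types (L : seq (set E)) (T : bctree R n) (X : bc_setting R n).

Definition convex_system L := forall A, A \in L -> convex_set (A : set E).

Lemma interP L (x : E) : inter L x <-> forall A, A \in L -> A x.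
Proof.
rewrite /inter; elim: L => [|A L IH].
  by rewrite big_nil; split.
rewrite big_cons; split=> [[Ax /IH Lx] B|h].
  by rewrite inE => /orP[/eqP ->|/Lx].
split; first by apply: h; rewrite inE eqxx.
by apply/IH => B BL; apply: h; rewrite inE BL orbT.
Qed.

Lemma inter_subset L L' : {subset L <= L'} -> (inter L' `<=` inter L)%classic.
Proof. by move=> LL' x /interP h; apply/interP => A /LL'; exact: h. Qed.

Lemma inter_cons (A : set E) L : inter (A :: L) = A `&` inter L.
Proof. by rewrite /inter big_cons. Qed.

Lemma subset_cons (A : set E) L L' :
  {subset L <= L'} -> {subset A :: L <= A :: L'}.
Proof. by move=> LL' B; rewrite !inE => /orP[->//|/LL' ->]; rewrite orbT. Qed.

Lemma restrict_subset L L' :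
  {subset L <= L'} -> {subset Defs.restrict L <= Defs.restrict L'}.
Proof. by move=> LL' A /mapP[B BL ->]; apply: map_f; exact: LL'. Qed.

Lemma inter_restrict L : inter (Defs.restrict L) `<=` inter L.
Proof.
move=> x /interP h; apply/interP => A AL.
by have [] : (A `&` integer_points) x by apply: h; exact: map_f.
Qed.

Lemma convex_system_cons (A : set E) L :
  convex_set (A : set E) -> convex_system L -> convex_system (A :: L).
Proof. by move=> cA cL B; rewrite inE => /orP[/eqP ->|/cL]. Qed.

(** Convexity of the complement of a halfspace enters here. *)
Lemma lattice_certifier_label (G : set E) L : halfspace G -> convex_system L ->
  lattice_system (certifier_label G L).
Proof.
move=> [_ cG] cL A; rewrite inE => /orP[/eqP ->|/mapP[B /cL cB ->]].
  by exists (~` G) => //; rewrite setIC setDE.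
by exists B.
Qed.

Lemma valid_disjunction_cover p (D : p.-tuple (set E)) x :
  valid_disjunction D -> integer_points x -> exists i, tnth D i x.
Proof.
move=> [_ De] Zx; have := Zx; rewrite -{1}De -bigcup_seq => -[A /= AD [Ax _]].
by have /tnthP[i Ai] := AD; exists i; rewrite -Ai.
Qed.

(** Neither a disjunction nor a cut loses integer points, so the leaves of any valid tree cover
    [P]. *)
Lemma leaf_sets_cover X L T x : bc_valid X L T -> integer_points x ->
  inter L x -> exists2 S, leaf_sets L T S & S x.
Proof.
elim: T L => [w|p D T IH|G w T IH] L /=.
- by move=> _ _ Lx; exists (inter L).
- move=> [vD _ vT] Zx Lx; have [i Dx] := valid_disjunction_cover vD Zx.
  have [|S Sl Sx] := IH i _ (vT i) Zx; first by rewrite inter_cons.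
  by exists S => //; exists i.
- move=> [[_ vG] _ _ vT] Zx Lx.
  have [|S Sl Sx] := IH _ vT Zx.
    by rewrite inter_cons; split=> //; exact: (vG _ _).1.
  by exists S => //; right.
Qed.

Lemma leaf_sets_sub L T S : leaf_sets L T S -> S `<=` inter L.
Proof.
elim: T L S => [w|p D T IH|G w T IH] L S /=.
- by move=> ->.
- by move=> [i _ /IH]; rewrite inter_cons => h x /h[].
- case=> [-> x|/IH]; last by rewrite inter_cons => h x /h[].
  by rewrite /certifier_label inter_cons => -[_ /inter_restrict].
Qed.

(** This allows a tree to be grafted below a branching. Disjunctions and cuts remain valid when sets
    are added to the label; certificates at cuts are replaced through monotonicity. *)
Lemma bc_strengthen X L L' T :
  monotone_certificates (cert_checker X) -> {subset L <= L'} ->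
  convex_system L -> convex_system L' -> bc_valid X L T ->
  exists T', [/\ bc_valid X L' T', (bc_size T' <= bc_size T)%N &
    forall S', leaf_sets L' T' S' -> exists2 S, leaf_sets L T S & S' `<=` S].
Proof.
move=> mono; elim: T L L' => [w|p D T IH|G w T IH] L L' LL' cL cL' /=.
(* A certificate at an ordinary leaf is optional and does not count in the size, so it is
   dropped. *)
- move=> _; exists (Leaf R n None); split=> // S' ->; exists (inter L) => //.
  exact: inter_subset.
- move=> [[cD De] XD vT].
  have cDi i : convex_set (tnth D i : set E) by apply: cD; exact: mem_tnth.
  have /choice[T' hT'] := fun i => IH i _ _ (subset_cons (A := tnth D i) LL')
    (convex_system_cons (cDi i) cL) (convex_system_cons (cDi i) cL') (vT i).
  exists (Branch D T'); split=> /=.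
  + by split=> // i; have [] := hT' i.
  + by rewrite leq_add2l leq_sum// => i _; have [] := hT' i.
  + move=> S' [i _ lS']; have [_ _ /(_ _ lS')[S lS SS]] := hT' i.
    by exists S => //; exists i.
- move=> [[hG vG] XG cert vT].
  have [T' [vT' sT' lT']] := IH _ _ (subset_cons (A := G) LL')
    (convex_system_cons hG.1 cL) (convex_system_cons hG.1 cL') vT.
  have lab : {subset certifier_label G L <= certifier_label G L'}.
    by apply: subset_cons; exact: restrict_subset.
  have [w' cert' ww'] := mono _ _ _ (lattice_certifier_label hG cL)
    (lattice_certifier_label hG cL') lab cert.
  exists (Cut G w' T'); split=> /=.
  + split=> //; split=> // x [Zx L'x]; apply: vG; split=> //.
    exact: (inter_subset LL').
  + by rewrite leq_add// leq_add2l.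
  + move=> S' [->|/lT'[S lS SS]].
      by exists (inter (certifier_label G L)); [left|exact: inter_subset].
    by exists S => //; right.
Qed.

Lemma dot_intr (alpha z : 'rV[int]_n) :
  dot (map_mx intr alpha) (map_mx intr z) = (\sum_j alpha 0 j * z 0 j)%:~R :> R.
Proof.
rewrite dotE rmorph_sum; apply: eq_bigr => j _.
by rewrite !mxE rmorphM.
Qed.

Lemma split_valid (alpha : 'rV[int]_n) (beta : int) :
  valid_disjunction (split_disjunction R alpha beta).
Proof.
split.
  by move=> D; rewrite !inE => /orP[/eqP ->|/eqP ->];
    [exact: convex_le|exact: convex_ge].
rewrite /split_disjunction !big_cons big_nil setU0 -setIUl.
apply/setIidPr => _ [z _ <-]; rewrite /setU /= dot_intr !ler_int.
by rewrite lezD1; apply/orP; case: leP.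
Qed.

(** Below the right branch all leaf sets become empty: branching and the assumption on [T] give
    contradictory bounds. *)
Lemma split_validity X L T (alpha : 'rV[int]_n) (beta : int) :
  monotone_certificates (cert_checker X) ->
  disjunctions X (split_disjunction R alpha beta) ->
  convex_system L -> bc_valid X L T ->
  (forall S y, leaf_sets L T S -> S y ->
     dot (map_mx intr alpha) y < (beta + 1)%:~R) ->
  exists T', [/\ bc_valid X L T', (bc_size T' <= bc_size T + 2)%N &
    forall S, leaf_sets L T' S ->
      S `<=` [set x | dot (map_mx intr alpha) x <= beta%:~R]].
Proof.
move=> mono XD cL vT lT; set D := split_disjunction _ _ _ in XD.
pose D2 := [set x : E | (beta + 1)%:~R <= dot (map_mx intr alpha) x].
have LD2 : {subset L <= D2 :: L} by move=> A AL; rewrite inE AL orbT.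
have [T' [vT' sT' lT']] := bc_strengthen mono LD2 cL
  (convex_system_cons (@convex_ge _ _ _ _) cL) vT.
(* The two additional nodes are the new root and the bare left leaf. *)
exists (Branch (in_tuple D) (fun i => if i == 0 then Leaf R n None else T')).
split=> /=.
- split=> //; first exact: split_valid.
  by move=> i; case: eqP => // /eqP i0; case: i i0 => -[|[|//]].
- by rewrite !big_ord_recl big_ord0 /= addn0 addnA addnC leq_add2r.
- move=> S [[[|[|//]] lt2] _] /=.
    by move=> ->; rewrite inter_cons => x [].
  move=> lS; have [S0 lS0 SS0] := lT' _ lS.
  move=> y Sy; have := lT _ _ lS0 (SS0 _ Sy).
  by have := leaf_sets_sub lS Sy; rewrite inter_cons => -[/= + _]; rewrite ltNge => ->.
Qed.

End Trees.

Theorem theorem4p8 (R : realType) (n t : nat) (K K' : 'I_t -> set 'rV[R]_n)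
    (P P' : set 'rV[R]_n) (X : bc_setting R n)
    (relax : forall i, lattice_convex (K i) /\ relaxation (K' i) (K i))
    (defP : P = \bigcap_(i in [set: 'I_t]) K i)
    (defP' : P' = \bigcap_(i in [set: 'I_t]) K' i)
    (polyP' : polyhedron P')
    (recP' : rational_cone (recession_cone P'))
    (restrP' : P = P' `&` integer_points)
    (fullP : full_dimensional (conv_hull P))
    (ratP : rational_polytope (conv_hull P))
    (certX : sound_and_complete (cert_checker X))
    (monoX : monotone_certificates (cert_checker X))
    (splits : forall (alpha : 'rV[int]_n) (beta : int), alpha != 0 ->
       disjunctions X (split_disjunction R alpha beta)) :
  let L := [seq K' i | i : 'I_t] in
  (membership_complexity X L P <= facet_complexity X L P)%E /\
  (facet_complexity X L P <= membership_complexity X L P + 2%:E)%E.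
Proof.
move=> L.
have cL : convex_system L.
  by move=> _ /mapP[i _ ->]; have [_ []] := relax i.
have interL : inter L = P'.
  rewrite defP'; apply/seteqP; split=> x.
    by move=> /interP h i _; apply: h; apply: map_f; rewrite mem_enum.
  by move=> h; apply/interP => _ /mapP[i _ ->]; exact: h.
set C := conv_hull P in fullP ratP.
have cC : convex_set (C : set 'rV[R]_n) by exact: convex_conv_hull.
have [s CE] := ratP.
pose q (i : 'I_(size s)) := tnth (in_tuple s) i.
have {}CE : C = conv_hull (range (fun i => map_mx ratr (q i))).
  rewrite CE; congr conv_hull; apply/seteqP; split.
    by move=> _ [y /= /(tnthP (in_tuple s))[i ->] <-]; exists i.
  by move=> _ [i _ <-]; exists (q i) => //=; exact: mem_tnth.
split.
- apply: ge_ereal_sup => _ [x Cx <-].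
  have [a [b [Cab Ff bx]]] : exists a b, [/\ C `<=` [set y | dot a y <= b],
      is_facet C (C `&` [set y | dot a y = b]) & b < dot a x].
    have := @facet_separation R n _ (fun i => map_mx ratr (q i)).
    by rewrite -CE; exact.
  have [_ [k [dC dF]]] := Ff.
  set F := C `&` _ in Ff dF.
  apply: (@le_trans _ _ (facet_validity_complexity X L P F)); last first.
    by apply: ereal_sup_ubound; exists F.
  apply: le_ereal_inf_tmp => _ [H FH <-].
  (* It suffices that every tree proving [H] valid also excludes [x], so that the infimum for [x]
     runs over a larger set of trees. *)
  apply: ereal_inf_le_tmp => _ [T [vT lT] <-]; exists T => //; split=> // Qx.
  have cH : convex_set (H : set 'rV[R]_n) by case: FH => -[].
  have QH : \bigcup_(S in leaf_sets L T) S `<=` H by move=> y [S /lT]; apply.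
  have := defines_facet_sub cC fullP Cab dC dF FH (conv_hull_sub cH QH Qx).
  by rewrite /= leNgt bx.
apply: ge_ereal_sup => _ [F [[a [b [Cab FE]]] [k [dC dF]]] <-]; subst F.
have [c [alpha [beta [c0 aE bE]]]] := facet_integral CE fullP Cab dC dF.
have a0 := facet_normal_neq0 Cab erefl dC dF.
have alpha0 : alpha != 0.
  by apply: contraNneq a0 => al0; rewrite aE al0 map_mx0 scaler0.
(* Dividing by [c] > 0 gives integral data for the same facet. *)
pose a' : 'rV[R]_n := map_mx intr alpha; pose b' : R := beta%:~R.
have {}Cab : C `<=` [set x | dot a' x <= b'].
  by move=> x /Cab /=; rewrite aE bE dotZl ler_pM2l.
have HE : [set x | dot a x = b] = [set x | dot a' x = b'].
  apply/seteqP; split=> x /=; rewrite aE bE dotZl; last by move=> ->.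
  by apply: mulfI; rewrite gt_eqF.
rewrite HE in dF *.
have a'0 : a' != 0 by exact: facet_normal_neq0 Cab erefl dC dF.
set F := C `&` _ in dF *.
have [f [Ff [e e0 he]]] := facet_interior cC fullP Cab erefl dC dF.
have P0 : P' `&` integer_points !=set0.
  rewrite -restrP'; apply/set0P/eqP => P0; have [y [_ [+ _ _ _]]] := fullP.
  by rewrite /C P0 conv_hull0.
have [M hM] : exists M, forall y, P' y -> `|y| <= M.
  apply: polyhedron_bounded polyP' _; apply: (@recession_cone_trivial _ _ _ C) => //.
    by rewrite -restrP'; exact: sub_conv_hull.
  by move=> w; rewrite CE; exact: conv_hull_range_bounded.
have fb : dot a' f = b' by case: Ff.
(* The apexes will be points [y] of [P'] with [a' . y >= b' + 1]: their gap to the hyperplane is at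
   least 1 and their distance to [f] at most [M + |f|]. *)
have [r r0 hr] := facet_pyramid (M + `|f|) fb e0 ltr01 he.
have a'n : 0 < `|a'| by rewrite normr_gt0.
pose d := (r / `|a'|) *: a'.
have ra : 0 < r / `|a'| by exact: divr_gt0.
have dr : `|d| <= r by rewrite normrZ (gtr0_norm ra) divfK// gt_eqF.
have ad : 0 < dot a' d by rewrite dotZr mulr_gt0// dot_gt0.
have Cx : ~ C (f + d).
  by move=> /Cab /=; rewrite dotDr fb; lra.
have fin2 : (2%:E : \bar R)%E \is a fin_num by [].
apply: (@le_trans _ _ (point_membership_complexity X L (f + d) + 2%:E)%E); last first.
  by rewrite leeD2r//; apply: ereal_sup_ubound; exists (f + d).
(* Moving the finite summand 2 to the left lets the infimum be bounded tree by tree, including when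
   no tree exists. *)
rewrite -leeBlDr//; apply: le_ereal_inf_tmp => _ [T [vT Tx] <-].
rewrite leeBlDr//.
have [|T' [vT' sT' lT']] := split_validity monoX (splits _ beta alpha0) cL vT.
  (* Otherwise [f + d] lies in the pyramid with apex [y] over the facet. The apex is a leaf point
     and the base lies in the hull of [P], which the leaves cover, so [T] would not separate
     [f + d]. *)
  move=> S y lS Sy; rewrite ltNge; apply/negP; rewrite intrD => yb; apply: Tx.
  have P'y : P' y by rewrite -interL; exact: leaf_sets_sub lS _ Sy.
  have q1 : 1 <= dot a' y - b' by rewrite lerBrDl.
  have [z [u [[Cz _] u0 u1 ->]]] : exists z u,
      [/\ F z, 0 <= u, u <= 1 & f + d = u *: y + (1 - u) *: z].
    apply: hr => //.
    - by rewrite (le_trans q1)// ler_norm.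
    - by rewrite (le_trans (ler_normB _ _))// lerD2r hM.
    - by rewrite divr_ge0 ?(ltW ad)//; lra.
  have /convex_setP := @convex_conv_hull _ _ (\bigcup_(S in leaf_sets L T) S).
  apply=> //; first by apply: sub_conv_hull; exists S.
  move: Cz; apply: conv_hull_sub; first exact: convex_conv_hull.
  move=> p; rewrite restrP' -interL => -[Lp Zp]; apply: sub_conv_hull.
  by have [S' lS' S'p] := leaf_sets_cover vT Zp Lp; exists S'.
(* Among the halfspaces defining the facet, the closed one bounds the minimum. *)
apply: (@le_trans _ _ (validity_complexity X L [set x | dot a' x <= b'])).
  apply: ereal_inf_lbound; exists [set x | dot a' x <= b'] => //.
  by split=> //; [exact: halfspace_le|rewrite boundary_le].
apply: (@le_trans _ _ (bc_size T')%:R%:E).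
  by apply: ereal_inf_lbound; exists T'.
by rewrite -EFinD lee_fin -natrD ler_nat.
Qed.
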